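(* For all positive integers $m,n$, $$\sum_{k=1}^n \binom{2n}{n-k} k^{2m} = \sum_{\ell=0}^m (-1)^\ell\, 2^{2n-2\ell-1}\, \langle 2n\rangle_{2\ell}\, \sigma_{m,\ell}(n).$$
   Context: Falling factorial: $\langle x\rangle_0=1$ and $\langle x\rangle_j = x(x-1)\cdots(x-j+1)$ for positive integers $j$. For nonnegative integers $\ell\le m$ and an indeterminate $y$, $\sigma_{m,\ell}(y)$ denotes the coefficient of $T^{m-\ell}$ in the formal power series $\prod_{j=0}^{\ell} \frac{1}{1-T(y-j)^2}$; equivalently $\sigma_{m,\ell}(y)=\sum_{0\le k_1\le k_2\le\cdots\le k_{m-\ell}\le \ell}\prod_{i=1}^{m-\ell}(y-k_i)^2$ (the complete homogeneous symmetric polynomial of degree $m-\ell$ in $y^2,(y-1)^2,\dots,(y-\ell)^2$). *)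

(* Defs.v *)
From mathcomp Require Import all_boot all_order all_algebra.

Set Implicit Arguments.
Unset Strict Implicit.
Unset Printing Implicit Defensive.

Import GRing.Theory.
Local Open Scope ring_scope.

Section FormalPowerSeries.

Variable R : comUnitRingType.

(* A formal power series is identified with its sequence of coefficients. *)
Definition fps := nat -> R.

Implicit Types f g : fps.

Definition fps_one : fps := fun d => (d == 0)%:R.

Definition fps_mul f g : fps := fun d => \sum_(i < d.+1) f i * g (d - i)%N.

Definition fps_of_poly (p : {poly R}) : fps := fun d => p`_d.

(* The first d coefficients of 1 / f, solved one after the other from
   \sum_(i <= d) f_i g_(d - i) = 0 for d > 0. *)
Fixpoint fps_inv_seq f d : seq R :=
  if d is d'.+1 then
    let s := fps_inv_seq f d' in
    rcons s ((f 0)^-1 * ((d' == 0)%:R - \sum_(i < d') f i.+1 * s`_(d' - i.+1)))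
  else [::].

(* Multiplicative inverse, meaningful when f 0 is a unit: see fps_mulfV. *)
Definition fps_inv f : fps := fun d => (fps_inv_seq f d.+1)`_d.

Lemma size_fps_inv_seq f d : size (fps_inv_seq f d) = d.
Proof. by elim: d => //= d IH; rewrite size_rcons IH. Qed.

Lemma nth_fps_inv_seq f d i : (i < d)%N -> (fps_inv_seq f d)`_i = fps_inv f i.
Proof.
elim: d => // d IH; rewrite ltnS leq_eqVlt => /predU1P[-> //|ltid] /=.
by rewrite nth_rcons size_fps_inv_seq ltid IH.
Qed.

Lemma fps_mulfV f : f 0 \is a GRing.unit -> fps_mul f (fps_inv f) =1 fps_one.
Proof.
move=> f0U d; rewrite /fps_mul big_ord_recl subn0 {1}/fps_inv /=.
rewrite nth_rcons size_fps_inv_seq ltnn eqxx mulrA divrr // mul1r.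
rewrite -[RHS](subrK (\sum_(i < d) f i.+1 * (fps_inv_seq f d)`_(d - i.+1))).
congr (_ + _); apply: eq_bigr => i _; rewrite nth_fps_inv_seq //.
by rewrite ltn_subrL /= (leq_ltn_trans _ (ltn_ord i)).
Qed.

End FormalPowerSeries.

(* \prod_(j <= l) 1 / (1 - T (y - j)^2) as a power series in T over Q[y];
   the inner 'X is y and the outer one is T. *)
Definition sigma_series (l : nat) : fps {poly rat} :=
  \big[@fps_mul {poly rat} / fps_one {poly rat}]_(j < l.+1)
    fps_inv (fps_of_poly (1 - 'X * (('X - j%:R) ^+ 2)%:P)).

(* Intended for l <= m only, since m - l is truncated. *)
Definition sigma (m l : nat) : {poly rat} := sigma_series l (m - l)%N.

(* Main.v *)
Require Import Defs.
From mathcomp Require Import all_boot all_order all_algebra.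
From mathcomp Require Import ring zify.

Import GRing.Theory.
Local Open Scope ring_scope.

(** Since [k^2m] is even in [k] and vanishes at [k = 0], twice the left-hand side
    is the sum of [C(2n,i) ((n-i)^2)^m] over [0 <= i <= 2n].  Newton interpolation
    of [x^m] at the nodes [n^2, (n-1)^2, ...] has the [sigma m l] as its divided
    differences, and at [x = (n-i)^2] its [l]-th basis polynomial is
    [(-1)^l <i>_l <2n-i>_l].  Finally the sum over [i] of
    [C(2n,i) <i>_l <2n-i>_l] is [<2n>_2l 2^(2n-2l)]. *)

Section CompleteSymmetric.

Variable R : comUnitRingType.
Implicit Types (a : nat -> R) (l d m : nat) (x c : R).

(** The series to invert has no coefficients beyond [1] and [- c], so degree [d.+1] of its product
    with the inverse links two consecutive terms of the inverse. *)
Lemma fps_inv_geometric c d :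
  fps_inv (fps_of_poly (1 - 'X * c%:P)) d = c ^+ d.
Proof.
set f := fps_of_poly _.
have fE i : f i = (i == 0%N)%:R - (i == 1%N)%:R * c.
  by rewrite /f /fps_of_poly coefB coef1 coefMC coefX.
have f0 : f 0%N = 1 by rewrite fE mul0r subr0.
have f1 : f 1%N = - c by rewrite fE mul1r sub0r.
have mulV : fps_mul f (fps_inv f) =1 fps_one R.
  by apply: fps_mulfV; rewrite f0 unitr1.
elim: d => [|d IH].
  by have := mulV 0%N; rewrite /fps_mul big_ord_recl big_ord0 addr0 f0 mul1r.
have := mulV d.+1; rewrite /fps_mul /fps_one !big_ord_recl big1 => [|i _]; last first.
  by rewrite fE /= mul0r subr0 mul0r.
rewrite addr0 f0 f1 subn0 mul1r /= subSS subn0 IH exprS mulNr.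
exact: subr0_eq.
Qed.

(** Series are functions compared pointwise, so factors cannot be replaced inside the product by
    plain rewriting. *)
Lemma eq_big_fps_mul (I : finType) (F G : I -> fps R) :
    (forall i, F i =1 G i) ->
  \big[@fps_mul R/fps_one R]_i F i =1 \big[@fps_mul R/fps_one R]_i G i.
Proof.
move=> FG; elim/big_rec2: _ => // i f g _ fg d.
by apply: eq_bigr => j _; rewrite FG fg.
Qed.

(** Generating series of the complete homogeneous symmetric polynomials in the first [l] values of
    [a], as a product of geometric series. *)
Definition complete_sym a l : fps R :=
  \big[@fps_mul R/fps_one R]_(j < l) (fun d => a j ^+ d).

Lemma complete_symSl a l :
  complete_sym a l.+1 = fps_mul (fun d => a 0%N ^+ d) (complete_sym (a \o S) l).
Proof. by rewrite /complete_sym big_ord_recl. Qed.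

Lemma complete_sym0r a l : complete_sym a l 0%N = 1.
Proof.
elim: l a => [|l IH] a; first by rewrite /complete_sym big_ord0.
by rewrite complete_symSl /fps_mul big_ord_recl big_ord0 IH mul1r addr0.
Qed.

(** Monomials are split according to whether they contain [a 0]. *)
Lemma complete_symSS a l d :
  complete_sym a l.+1 d.+1 =
  complete_sym (a \o S) l d.+1 + a 0%N * complete_sym a l.+1 d.
Proof.
rewrite complete_symSl /fps_mul big_ord_recl expr0 mul1r subn0 mulr_sumr.
by congr (_ + _); apply: eq_bigr => i _; rewrite /= /bump /= exprS mulrA.
Qed.

Lemma complete_sym1 a d : complete_sym a 1 d = a 0%N ^+ d.
Proof.
elim: d => [|d IH]; first by rewrite complete_sym0r.
by rewrite complete_symSS IH /complete_sym big_ord0 /fps_one add0r -exprS.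
Qed.

(** Induction for all node sequences: in [x^(m+1) = (x - a 0) x^m + a 0 x^m], the first [x^m] is
    expanded at the shifted nodes, the second at the original ones. *)
Lemma newton_interpolation_expr a x m :
  x ^+ m = \sum_(l < m.+1) complete_sym a l.+1 (m - l)%N * \prod_(j < l) (x - a j).
Proof.
elim: m a => [|m IH] a.
  by rewrite big_ord_recl !big_ord0 complete_sym0r expr0 mulr1 addr0.
transitivity ((x - a 0%N) * x ^+ m + a 0%N * x ^+ m); first by rewrite exprS; ring.
rewrite {1}(IH (a \o S)) {1}(IH a) !mulr_sumr.
rewrite [RHS]big_ord_recl big_ord_recr [X in _ + X = _]big_ord_recl /=.
rewrite [X in _ = _ + X]big_ord_recr /= !subnn !complete_sym0r.
rewrite /= /bump /= !subn0 !big_ord0 !complete_sym1.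
under [X in _ + (_ + X) = _]eq_bigr do rewrite add1n.
under [X in _ = _ + (X + _)]eq_bigr do rewrite add1n.
rewrite [X in _ = _ + (_ + 1 * X)]big_ord_recl /=.
under [X in _ = _ + (_ + 1 * (_ * X))]eq_bigr do rewrite /bump add1n.
(* The end terms [l = 0] and [l = m.+1] are split off; the others match by [complete_symSS]. *)
have -> : \sum_(i < m) complete_sym a i.+2 (m.+1 - i.+1)%N *
    \prod_(j < i.+1) (x - a j) =
    \sum_(i < m) (x - a 0%N) * (complete_sym (a \o S) i.+1 (m - i)%N *
      \prod_(j < i) (x - a j.+1)) +
    \sum_(i < m) a 0%N * (complete_sym a i.+2 (m - i.+1)%N *
      \prod_(j < i.+1) (x - a j)).
  rewrite -big_split; apply: eq_bigr => i _ /=.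
  rewrite subSS -(subnSK (ltn_ord i)) complete_symSS big_ord_recl.
  under [in LHS]eq_bigr do rewrite /= /bump /= add1n.
  by rewrite /=; ring.
by rewrite exprS; ring.
Qed.

End CompleteSymmetric.

Lemma sigma_complete_sym m l :
  sigma m l = complete_sym _ (fun j => ('X - j%:R) ^+ 2) l.+1 (m - l)%N.
Proof.
by apply: eq_big_fps_mul => j d; rewrite fps_inv_geometric.
Qed.

(** Absorption, [i C(N,i) = N C(N-1,i-1)], lowers [a], and the reflection of [i] to [N - i] lets it
    lower [b]; a plain binomial sum remains. If [a + b > N], both sides vanish. *)
Lemma sum_bin_ffact N a b :
  (\sum_(i < N.+1) 'C(N, i) * (i ^_ a * (N - i) ^_ b) =
   N ^_ (a + b) * 2 ^ (N - (a + b)))%N.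
Proof.
have peel M c d :
    (\sum_(i < M.+2) 'C(M.+1, i) * (i ^_ c.+1 * (M.+1 - i) ^_ d) =
     M.+1 * \sum_(i < M.+1) 'C(M, i) * (i ^_ c * (M - i) ^_ d))%N.
  rewrite big_ord_recl ffact0n mul0n muln0 add0n big_distrr.
  apply: eq_bigr => i _.
  by rewrite /= /bump /= add1n subSS ffactSS !mulnA [('C(_, _) * i.+1)%N]mulnC -mul_bin_diag.
elim: a N b => [|a IH] N b; last first.
  case: N => [|M]; last by rewrite peel IH addSn ffactSS subSS mulnA.
  by rewrite big_ord_recl big_ord0 !ffact0n.
rewrite add0n; elim: b N => [|b IHb] N.
  under eq_bigr do rewrite !ffactn0 !muln1.
  rewrite ffactn0 mul1n subn0 -[2%N]/(1 + 1)%N expnDn.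
  by apply: eq_bigr => i _; rewrite !exp1n !muln1.
case: N => [|M]; first by rewrite big_ord_recl big_ord0 !ffact0n.
have flip K c : (\sum_(i < K.+1) 'C(K, i) * (i ^_ 0 * (K - i) ^_ c) =
    \sum_(i < K.+1) 'C(K, i) * (i ^_ c * (K - i) ^_ 0))%N.
  rewrite (reindex_inj rev_ord_inj); apply: eq_bigr => i _.
  have leiK : (i <= K)%N by rewrite -ltnS.
  by rewrite /= subSS bin_sub // subKn // !ffactn0 mul1n muln1.
by rewrite flip peel -flip IHb ffactSS subSS mulnA.
Qed.

Lemma prod_natB_ffact (R : comPzRingType) (p l : nat) :
  \prod_(j < l) (p%:R - j%:R) = (p ^_ l)%:R :> R.
Proof.
elim: l => [|l IH]; first by rewrite big_ord0.
rewrite big_ord_recr /= IH ffactnSr natrM.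
have [lelp|ltpl] := leqP l p; first by rewrite natrB.
(* The truncated [p - l] is wrong here, but the product is already zero. *)
by rewrite ffact_small // !mul0r.
Qed.

(** As a difference of squares, each factor is [- (i - j) ((2n - i) - j)]. *)
Lemma newton_basis_at_square (R : comPzRingType) (n i l : nat) :
    (i <= 2 * n)%N ->
  \prod_(j < l) ((n%:R - i%:R) ^+ 2 - (n%:R - j%:R) ^+ 2) =
  (-1) ^+ l * (i ^_ l * (2 * n - i) ^_ l)%:R :> R.
Proof.
move=> lei; rewrite natrM -!prod_natB_ffact -big_split /=.
rewrite -[in (-1) ^+ l](card_ord l) -prodrN -?big_split /=.
by apply: eq_bigr => j _; rewrite natrB // natrM; ring.
Qed.

Lemma natr_square_expr_newton (n i m : nat) : (i <= 2 * n)%N ->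
  ((n%:R - i%:R) ^+ 2) ^+ m =
  \sum_(l < m.+1) (sigma m l).[n%:R] *
    ((-1) ^+ l * (i ^_ l * (2 * n - i) ^_ l)%:R) :> rat.
Proof.
(* The nodes are polynomials in [y]: interpolation takes place in Q[y] at a constant, followed by
   evaluation at [y = n]. *)
move=> lei; pose a (j : nat) : {poly rat} := ('X - j%:R) ^+ 2.
have := congr1 (horner^~ n%:R)
  (newton_interpolation_expr _ a (((n%:R - i%:R) ^+ 2)%:P) m).
rewrite -polyC_exp hornerC => ->; rewrite horner_sum; apply: eq_bigr => l _.
rewrite sigma_complete_sym hornerM -newton_basis_at_square // horner_prod.
congr (_ * _); apply: eq_bigr => j _.
by rewrite /a !hornerE -polyC_natr hornerC.
Qed.

Lemma sum_symmetric_half (R : nmodType) (F : nat -> R) n :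
    (forall i, (i <= n)%N -> F (2 * n - i)%N = F i) -> F n = 0 ->
  \sum_(i < (2 * n).+1) F i = (\sum_(1 <= k < n.+1) F (n - k)%N) *+ 2.
Proof.
move=> Fsym Fn0; rewrite -(big_mkord xpredT) (big_cat_nat (n := n)) //=; last by lia.
rewrite [X in _ + X]big_ltn ?Fn0 ?add0r; last by lia.
rewrite mulr2n; congr (_ + _).
  rewrite big_nat_rev [RHS]big_add1 /= add0n.
  by apply: eq_big_nat.
rewrite -{1}[n.+1]add1n -[(2 * n).+1](_ : n.+1 + n = _)%N; last by lia.
rewrite big_addn addnK; apply: eq_big_nat => i /andP[_ ltin].
rewrite -[RHS]Fsym; last by lia.
by congr F; lia.
Qed.

Theorem theorem2 (m n : nat) (m_gt0 : (0 < m)%N) (n_gt0 : (0 < n)%N) :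
  \sum_(1 <= k < n.+1) ('C(2 * n, n - k))%:R * (k%:R : rat) ^+ (2 * m) =
  \sum_(0 <= l < m.+1)
    (-1) ^+ l * (2%:R : rat) ^ ((2 * n)%:Z - (2 * l)%:Z - 1)
      * ((2 * n) ^_ (2 * l))%:R * (sigma m l).[n%:R].
Proof.
have two_neq0 : 2%:R != 0 :> rat by [].
pose F i : rat := 'C(2 * n, i)%:R * ((n%:R - i%:R) ^+ 2) ^+ m.
(* Doubling cancels the [- 1] in the exponent and lets [k] account for both [n - k] and [n + k]. *)
apply: (mulfI two_neq0); rewrite [LHS]mulr_natl.
transitivity (\sum_(i < (2 * n).+1) F i).
  rewrite sum_symmetric_half => [|i lein|]; last 2 first.
  - rewrite /F bin_sub; last by lia.
    rewrite natrB ?natrM; last by lia.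
    by congr (_ * _ ^+ m); ring.
  (* Positivity of [m] matters: the middle term contains [0 ^ m]. *)
  - by rewrite /F subrr expr2 mul0r expr0n eqn0Ngt m_gt0 mulr0.
  congr (_ *+ 2); apply: eq_big_nat => k /andP[_ ltkn].
  by rewrite /F natrB // exprM; congr (_ * (_ ^+ 2) ^+ m); ring.
transitivity (\sum_(i < (2 * n).+1) \sum_(l < m.+1)
    (sigma m l).[n%:R] * (-1) ^+ l *
    ('C(2 * n, i) * (i ^_ l * (2 * n - i) ^_ l))%:R).
  apply: eq_bigr => i _; rewrite /F natr_square_expr_newton ?mulr_sumr; last by rewrite -ltnS.
  by apply: eq_bigr => l _; rewrite [in RHS]natrM -[RHS]mulrA mulrCA [in LHS](mulrCA _%:R).
rewrite exchange_big big_mkord mulr_sumr; apply: eq_bigr => l _.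
rewrite -mulr_sumr -natr_sum sum_bin_ffact addnn -mul2n natrM.
(* For [l > n] the falling factorial vanishes, so the truncated and integer exponents need to agree
   only for [l <= n]. *)
have [leln|ltnl] := leqP l n; last first.
  by rewrite ffact_small ?mulr0 ?mul0r ?mulr0 //; lia.
rewrite subzn; last by lia.
rewrite natrX expfzDr // -exprnP exprN1.
by field.
Qed.
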